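(* Product structure does not imply geodesic structure. That is, there is a class of graphs that admits product structure (has bounded row treewidth) but does not admit geodesic structure (has unbounded geodesic treewidth).
   Context: All graphs are undirected, without loops and multi-edges. A geodesic in a graph $G$ is a path in $G$ that is a shortest path between its two endpoints (a single vertex is a geodesic). A partition $\mathcal{P}$ of $G$ is a set of induced subgraphs (parts) whose vertex sets partition $V(G)$; it is a partition into geodesics if the vertices of each part are exactly the vertices of a geodesic of $G$. The quotient $G/\mathcal{P}$ is the simple graph obtained from $G$ by contracting (identifying) each part into a single vertex, removing loops and multi-edges. The geodesic treewidth of $G$ is the smallest $k$ for which there is a partition $\mathcal{P}$ of $G$ into geodesics such that $G/\mathcal{P}$ has treewidth $k$. The row treewidth of $G$ is the smallest $k$ such that $G$ is isomorphic to a subgraph of the strong product $H \boxtimes P$ for some graph $H$ of treewidth $k$ and some path $P$. A class of graphs admits geodesic structure if there is a constant bounding the geodesic treewidth of all its members, and it admits product structure if there is a constant bounding the row treewidth of all its members. *)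

(* Defs.v *)
From mathcomp Require Import all_boot.
From mathcomp Require Import boolp.

Set Implicit Arguments.
Unset Strict Implicit.
Unset Printing Implicit Defensive.

Record sgraph := SGraph {
  vertex :> finType;
  adj : rel vertex;
  adj_sym : symmetric adj;
  adj_irr : irreflexive adj }.

Lemma least_subproof (Q : nat -> Prop) : (exists n, Q n) -> exists n, `[< Q n >].
Proof. by case=> n Qn; exists n; apply/asboolP. Qed.

Definition least (Q : nat -> Prop) (exQ : exists n, Q n) : nat :=
  ex_minn (least_subproof exQ).

Lemma leastP (Q : nat -> Prop) (exQ : exists n, Q n) :
  Q (least exQ) /\ forall n, Q n -> least exQ <= n.
Proof.
rewrite /least; case: ex_minnP => m /asboolP Qm min_m.
by split=> // n Qn; apply/min_m/asboolP.
Qed.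

(* The constraint on c excludes the degenerate cycles [::] and [:: x; y]. *)
Definition acyclic (G : sgraph) : Prop :=
  forall c : seq G, 2 < size c -> ~~ ucycleb (@adj G) c.

Definition connected (G : sgraph) : Prop :=
  forall x y : G, connect (@adj G) x y.

Definition is_tree (T : sgraph) : Prop :=
  [/\ 0 < #|T|, connected T & acyclic T].

Definition tree_decomposition (G T : sgraph) (B : T -> {set G}) : Prop :=
  [/\ is_tree T,
      forall v : G, exists t : T, v \in B t,
      forall u v : G, adj u v -> exists t : T, (u \in B t) && (v \in B t)
    & forall (v : G) (s t : T), v \in B s -> v \in B t ->
        connect [rel a b | [&& adj a b, v \in B a & v \in B b]] s t].

(* Truncated predecessor: the graph without vertices gets width 0, not -1. *)
Definition width (G T : sgraph) (B : T -> {set G}) : nat :=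
  (\max_(t : T) #|B t|).-1.

Definition path_rel n : rel 'I_n.+1 := fun i j => (i.+1 == j) || (j.+1 == i).

Lemma path_rel_sym n : symmetric (@path_rel n).
Proof. by move=> i j; rewrite /path_rel orbC. Qed.

Lemma path_rel_irr n : irreflexive (@path_rel n).
Proof. by move=> i; rewrite /path_rel orbb; apply/negbTE; rewrite gtn_eqF. Qed.

(* The path with n + 1 vertices. *)
Definition path_graph n : sgraph := SGraph (@path_rel_sym n) (@path_rel_irr n).

Lemma treewidth_subproof (G : sgraph) :
  exists k, exists (T : sgraph) (B : T -> {set G}),
    tree_decomposition B /\ width B = k.
Proof.
set B := fun _ : path_graph 0 => [set: G].
exists (width B), (path_graph 0), B; split=> //; split.
- split; first by rewrite card_ord.
    by move=> x y; rewrite (ord1 x) (ord1 y); apply: connect0.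
  move=> c c2; apply/negP=> /andP[_ /card_uniqP cE].
  by have := max_card (mem c); rewrite cE card_ord leqNgt (ltn_trans _ c2).
- by move=> v; exists ord0; rewrite inE.
- by move=> u v _; exists ord0; rewrite !inE.
- by move=> v s t _ _; rewrite (ord1 s) (ord1 t); apply: connect0.
Qed.

Definition treewidth (G : sgraph) : nat := least (treewidth_subproof G).

(* x :: p is the vertex sequence of a path, which has last x p as other end. *)
Definition graph_path (G : sgraph) (x : G) (p : seq G) : bool :=
  path (@adj G) x p && uniq (x :: p).

Definition geodesic (G : sgraph) (x : G) (p : seq G) : Prop :=
  graph_path x p /\
  forall q : seq G, graph_path x q -> last x q = last x p -> size p <= size q.

(* A part, being an induced subgraph, is given by its vertex set. *)
Definition geodesic_partition (G : sgraph) (P : {set {set G}}) : Prop :=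
  partition P [set: G] /\
  forall A : {set G}, A \in P ->
    exists (x : G) (p : seq G), geodesic x p /\ A = [set:: x :: p].

Section Quotient.
Variables (G : sgraph) (P : {set {set G}}).

Definition quotient_rel : rel {A : {set G} | A \in P} := fun A B =>
  (A != B) && [exists x in val A, exists y in val B, adj x y].

Lemma quotient_rel_sym : symmetric quotient_rel.
Proof.
suff sub A B : quotient_rel A B -> quotient_rel B A.
  by move=> A B; apply/idP/idP; apply: sub.
case/andP=> AB /exists_inP[x xA /exists_inP[y yB xy]].
rewrite /quotient_rel eq_sym AB; apply/exists_inP; exists y => //.
by apply/exists_inP; exists x; rewrite // adj_sym.
Qed.

Lemma quotient_rel_irr : irreflexive quotient_rel.
Proof. by move=> A; rewrite /quotient_rel eqxx. Qed.

Definition quotient : sgraph := SGraph quotient_rel_sym quotient_rel_irr.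
End Quotient.

Lemma geodesic_treewidth_subproof (G : sgraph) :
  exists k, exists P : {set {set G}},
    geodesic_partition P /\ treewidth (quotient P) = k.
Proof.
set P := [set [set x] | x : G].
exists (treewidth (quotient P)), P; split=> //; split.
  apply/and3P; split.
  - rewrite eqEsubset subsetT; apply/subsetP=> x _; apply/bigcupP.
    by exists [set x]; rewrite ?set11 ?imset_f.
  - apply/trivIsetP=> _ _ /imsetP[x _ ->] /imsetP[y _ ->] xy.
    by rewrite disjoints1 inE; apply: contraNneq xy => ->.
  - by apply/imsetP=> -[x _ /setP/(_ x)]; rewrite !inE eqxx.
move=> _ /imsetP[x _ ->]; exists x, [::]; split; first by split.
by apply/setP=> y; rewrite !inE.
Qed.

Definition geodesic_treewidth (G : sgraph) : nat :=
  least (geodesic_treewidth_subproof G).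

Section StrongProduct.
Variables H K : sgraph.

Definition strong_rel : rel (H * K) := fun u v =>
  [&& u != v, (u.1 == v.1) || adj u.1 v.1 & (u.2 == v.2) || adj u.2 v.2].

Lemma strong_rel_sym : symmetric strong_rel.
Proof.
move=> u v; rewrite /strong_rel eq_sym (eq_sym u.1) (eq_sym u.2).
by rewrite (adj_sym u.1) (adj_sym u.2).
Qed.

Lemma strong_rel_irr : irreflexive strong_rel.
Proof. by move=> u; rewrite /strong_rel eqxx. Qed.

Definition strong_product : sgraph := SGraph strong_rel_sym strong_rel_irr.
End StrongProduct.

(* G is isomorphic to a (not necessarily induced) subgraph of K. *)
Definition embeds (G K : sgraph) : Prop :=
  exists f : G -> K, injective f /\ forall x y : G, adj x y -> adj (f x) (f y).

Lemma row_treewidth_subproof (G : sgraph) :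
  exists k, exists (H : sgraph) (n : nat),
    treewidth H = k /\ embeds G (strong_product H (path_graph n)).
Proof.
exists (treewidth G), G, 0; split=> //.
exists (fun x => (x, ord0)); split=> [x y [] // | x y xy].
apply/and3P; split; rewrite /= ?xy ?eqxx ?orbT //.
by apply: contraTneq xy => -[->]; rewrite adj_irr.
Qed.

Definition row_treewidth (G : sgraph) : nat := least (row_treewidth_subproof G).

Definition bounded_on (C : sgraph -> Prop) (f : sgraph -> nat) : Prop :=
  exists c : nat, forall G : sgraph, C G -> f G <= c.

Definition admits_product_structure (C : sgraph -> Prop) : Prop :=
  bounded_on C row_treewidth.

Definition admits_geodesic_structure (C : sgraph -> Prop) : Prop :=
  bounded_on C geodesic_treewidth.

(* Main.v *)
(* Attach every vertex of a large grid to a path, the spine, running along its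
   columns, so that the columns advance at half the speed of the spine. A long
   geodesic then has to use the spine and contains at most six grid vertices.
   A tree decomposition of a quotient by geodesics whose bags have k + 1 parts
   thus yields one of the grid whose bags have at most 6(k + 1) vertices, but
   the bramble of crosses (a row together with a column) forces a bag with at
   least as many vertices as there are rows. Instead of a grid, the product
   of a star and a path is used: its row structure is decomposed by a star. *)
Require Import Defs.
From mathcomp Require Import all_boot zify.

Set Implicit Arguments.
Unset Strict Implicit.
Unset Printing Implicit Defensive.

(** * Subtrees of a tree, and brambles *)

Lemma connect_homo (T U : finType) (e : rel T) (e' : rel U) (f : T -> U) :
  (forall x y, e x y -> connect e' (f x) (f y)) ->
  forall x y, connect e x y -> connect e' (f x) (f y).
Proof.
move=> fe x y /connectP[p ep ->]; elim: p x ep => [|z p IHp] x /=.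
  by rewrite connect0.
by case/andP=> xz /IHp; apply/connect_trans/fe.
Qed.

Definition adj_in (G : sgraph) (S : {set G}) : rel G :=
  [rel a b | [&& adj a b, a \in S & b \in S]].

Definition connected_in (G : sgraph) (S : {set G}) : Prop :=
  {in S &, forall x y, connect (adj_in S) x y}.

Lemma connect_in_sym (G : sgraph) (S : {set G}) :
  connect_sym (adj_in S).
Proof.
apply: sym_connect_sym => x y.
by rewrite /adj_in /= adj_sym [(x \in S) && _]andbC.
Qed.

Lemma connected_in_center (G : sgraph) (S : {set G}) (z : G) :
  {in S, forall x, connect (adj_in S) x z} ->
  connected_in S.
Proof.
move=> zP x y xS yS; apply: connect_trans (zP x xS) _.
by rewrite connect_in_sym; apply: zP.
Qed.

(** A path from [a] to [b] avoiding the edge between them would close up with it to a cycle. *)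
Lemma acyclic_bridge (G : sgraph) (a b : G) :
  acyclic G -> adj a b ->
  ~~ connect [rel u v | adj u v && ((u, v) \notin [:: (a, b); (b, a)])] a b.
Proof.
move=> acG ab; apply/negP=> /connectP[p0 /shortenP[p ep up _] lp].
have sz : 2 < size (a :: p).
  case: p lp ep {up} => [|c [|d p]] //= lp; first by rewrite -lp adj_irr in ab.
  by rewrite -lp !inE eqxx andbF.
have /negP := acG _ sz; apply; rewrite /ucycleb up andbT.
rewrite /= rcons_path -lp adj_sym ab andbT.
by apply: sub_path ep => u v /andP[].
Qed.

(* If no node is common, send each node t to its neighbour towards a subtree
   avoiding t. In a tree this map has a 2-cycle {x, f x}, and the edge between
   x and f x then separates two of the subtrees. *)
Lemma subtree_helly (T : sgraph) (I : finType) (S : I -> {set T}) :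
  is_tree T -> (forall i, connected_in (S i)) ->
  (forall i j, exists2 t, t \in S i & t \in S j) ->
  exists t, forall i, t \in S i.
Proof.
case=> /card_gt0P[t0 _] coT acT coS meetS.
suff: [exists t, forall i, t \in S i].
  by case/existsP=> t /forallP; exists t.
apply: contraT => /existsPn noS.
pose away t := [rel a b : T | [&& adj a b, a != t & b != t]].
have step t : exists u, adj t u /\ exists2 i, t \notin S i &
    {in S i, forall z, connect (away t) u z}.
  have /forallPn[i tSi] := noS t.
  have [z zSi _] := meetS i i.
  case/connectP: (coT t z) => p0 /shortenP[[|u p] /= ep up _ zE].
    by rewrite zE in zSi; rewrite zSi in tSi.
  case/andP: ep => tu ep; exists u; split=> //; exists i => // w wSi.
  apply: (@connect_trans _ _ z).
    apply/connectP; exists p => //.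
    have : all (predC1 t) (u :: p).
      by apply/allP=> x xp /=; apply: contraTneq xp => ->; case/andP: up.
    elim: p u ep {up tu zE} => //= v p IHp u /andP[uv ep] /and3P[ut vt pt].
    by rewrite uv ut vt /=; apply: IHp; rewrite //= vt.
  have := coS i z w zSi wSi; apply: connect_sub => a b /= /and3P[ab aS bS].
  apply: connect1; rewrite /= ab /=.
  by apply/andP; split; apply: contraNneq tSi => <-.
have [f fP] := fin_all_exists step.
have [y [k yk]] : exists y, exists k, iter k.+1 f y = y.
  have /trajectP[i lti itE] := looping_order f t0.
  exists (iter i f t0), (order f t0 - i).-1.
  rewrite prednK ?subn_gt0 // -iterD subnK ?itE //; exact: ltnW.
have cyc : fcycle f (orbit f y).
  by apply/(orbitPcycle 3 0); exists k.
(* A longer orbit would be a cycle of [T]. *)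
have ord2 : order f y <= 2.
  rewrite leqNgt; apply/negP=> gt2.
  have := acT (orbit f y); rewrite size_orbit => /(_ gt2)/negP; apply.
  rewrite /ucycleb orbit_uniq andbT.
  by apply: sub_cycle cyc => a b /= /eqP <-; case: (fP a).
have [yfy [i yi iP]] := fP y.
have ffy : f (f y) = y.
  have /(orbitPcycle 0 4) := cyc.
  case: (order f y) (order_gt0 f y) ord2 => [|[|[|m]]] //= _ _ E.
  by rewrite E adj_irr in yfy.
have [_ [j yj jP]] := fP (f y).
have [z zi zj] := meetS i j.
case/negP: (acyclic_bridge acT yfy).
set E := [rel u v | _].
have symE : connect_sym E.
  apply: sym_connect_sym => a b; rewrite /= adj_sym !inE !xpair_eqE.
  by rewrite orbC [(b == _) && _]andbC [(b == f y) && _]andbC.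
(* [z] is reached from [y] without meeting [f y], and from [f y] without meeting [y], so neither
   walk uses the removed edge. *)
apply: (@connect_trans _ _ z); last rewrite symE.
  move: (jP z zj); rewrite ffy; apply: connect_sub => a b /= /and3P[ab an bn].
  by apply: connect1; rewrite /= ab !inE !xpair_eqE (negPf an) (negPf bn) !andbF.
move: (iP z zi); apply: connect_sub => a b /= /and3P[ab an bn].
by apply: connect1; rewrite /= ab !inE !xpair_eqE (negPf an) (negPf bn) !andbF.
Qed.

(** The nodes whose bags meet [C i] form a subtree, since adjacent vertices share a bag. Two such
    subtrees share any node whose bag holds a common vertex of the two sets, so the Helly property
    applies. *)
Lemma bag_meets_bramble (G T : sgraph) (B : T -> {set G})
    (I : finType) (C : I -> {set G}) :
  tree_decomposition B -> (forall i, connected_in (C i)) ->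
  (forall i j, exists2 v, v \in C i & v \in C j) ->
  exists t, forall i, exists2 v, v \in C i & v \in B t.
Proof.
case=> treeT coverB edgeB coB coC meetC.
pose S i := [set t | [exists v in C i, v \in B t]].
have SP i t v : v \in C i -> v \in B t -> t \in S i.
  by move=> vC vt; rewrite inE; apply/exists_inP; exists v.
have [||t tS] := @subtree_helly T I S treeT; last first.
- by exists t => i; have:= tS i; rewrite inE => /exists_inP.
- move=> i j; have [v vi vj] := meetC i j; have [t vt] := coverB v.
  by exists t; apply: SP vt.
move=> i.
have stay v s t : v \in C i -> v \in B s -> v \in B t -> connect (adj_in (S i)) s t.
  move=> vC vs vt; have := coB v s t vs vt; apply: connect_sub => a b /=.
  by case/and3P=> ab va vb; apply: connect1; rewrite /adj_in /= ab !(SP i _ v).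
move=> s t; rewrite !inE => /exists_inP[u uC us] /exists_inP[v vC vt].
have /connectP[p ep pv] := coC i u v uC vC.
elim: p u uC s us ep pv => [|w p IHp] u uC s us /=.
  by move=> _ vu; rewrite vu in vt; apply: stay vt.
case/andP=> /and3P[uw _ wC] ep pv.
have [r /andP[ur wr]] := edgeB u w uw.
by apply: connect_trans (stay u s r uC us ur) _; apply: IHp ep pv.
Qed.

(** * The graphs and their row treewidth *)

Lemma treewidth_le (G T : sgraph) (B : T -> {set G}) k :
  tree_decomposition B -> (forall t, #|B t| <= k.+1) -> treewidth G <= k.
Proof.
move=> tdB Bk; have [_ min_tw] := leastP (treewidth_subproof G).
apply: (@leq_trans (width B)); first by apply: min_tw; exists T, B.
by rewrite /width -subn1 leq_subLR; apply/bigmax_leqP.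
Qed.

Section Star.
Variable I : finType.

Definition star_rel : rel (option I) := fun s t => (s == None) (+) (t == None).

Lemma star_sym : symmetric star_rel.
Proof. by move=> s t; rewrite /star_rel addbC. Qed.

Lemma star_irr : irreflexive star_rel.
Proof. by move=> s; rewrite /star_rel addbb. Qed.

Definition star : sgraph := SGraph star_sym star_irr.

Lemma star_is_tree : is_tree star.
Proof.
split; first by apply/card_gt0P; exists None.
  have cN (x : star) : connect (@adj star) x None.
    by case: x => [i|]; [apply: connect1 | apply: connect0].
  move=> x y; apply: connect_trans (cN x) _.
  by rewrite (sym_connect_sym (@adj_sym star)).
move=> c sz; apply/negP => /andP[cc uc].
by move: c sz cc uc => [|[?|] [|[?|] [|[?|] [|[?|] c]]]]//= _; rewrite /star_rel //=
  ?inE ?andbF ?andbT //= ?orbT //= ?andbF.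
Qed.

End Star.

Section Example.
Variable n : nat.

(* [None] is an apex, whose copies form the spine; the other vertices form a
   star with two-vertex blocks, with hub [Some (None, _)]. *)
Definition apexed_star_vertex : finType := option (option 'I_n.+1 * bool).

Definition apexed_star_rel : rel apexed_star_vertex := fun u v =>
  (u != v) && match u, v with
              | Some (Some i, _), Some (Some j, _) => i == j
              | _, _ => true
              end.

Lemma apexed_star_sym : symmetric apexed_star_rel.
Proof.
move=> u v; rewrite /apexed_star_rel eq_sym; congr (_ && _).
by case: u v => [[[i|] b]|] [[[j|] c]|].
Qed.

Lemma apexed_star_irr : irreflexive apexed_star_rel.
Proof. by move=> u; rewrite /apexed_star_rel eqxx. Qed.

Definition apexed_star : sgraph := SGraph apexed_star_sym apexed_star_irr.

(** Decompose along the star: every bag holds the apex and the hub block, and a leaf bag also its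
    own block, at most five vertices in all. *)
Lemma treewidth_apexed_star : treewidth apexed_star <= 4.
Proof.
pose B (t : star 'I_n.+1) := [set v : apexed_star |
  if v is Some (u, _) then (u == None) || (u == t) else true].
apply: (@treewidth_le _ _ B) => [|t].
  split=> [|||v s t].
  - exact: star_is_tree.
  - by move=> [[u b]|]; [exists u | exists None]; rewrite inE ?eqxx ?orbT.
  - move=> [[[i|] b]|] [[[j|] c]|] /andP[_ /= ij]; try by exists None; rewrite !inE.
    + by exists (Some i); rewrite !inE /= (eqP ij) eqxx.
    + by exists (Some i); rewrite !inE /= eqxx.
    + by exists (Some i); rewrite !inE /= eqxx.
    + by exists (Some j); rewrite !inE /= eqxx.
    + by exists (Some j); rewrite !inE /= eqxx.
  (* A vertex of a leaf block lies in a single bag, any other vertex in all of them. *)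
  have [leafv|cv] := boolP (if v is Some (Some _, _) then true else false).
    case: v leafv => [[[i|] b]|] // _; rewrite !inE /= => /eqP <- /eqP <-.
    exact: connect0.
  move=> _ _; have vB r : v \in B r by rewrite inE; case: v cv => [[[i|] b]|].
  have [_ coT _] := star_is_tree 'I_n.+1.
  apply: connect_sub (coT s t) => a b ab; apply: connect1.
  by rewrite /= !vB !andbT.
pose s : seq apexed_star := [:: None; Some (None, true); Some (None, false);
  Some (t, true); Some (t, false)].
apply: leq_trans (card_size s); apply/subset_leq_card/subsetP => v.
rewrite !inE; case: v => [[u b]|] //=.
by case/orP=> /eqP ->; case: b; rewrite !eqxx ?orbT.
Qed.

(* A vertex [(Some (i, b), y)] lies at height [2y + b] of the [i]-th column.
   Columns thus climb two steps per layer, whereas the spine climbs one. *)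
Definition column_height (b : bool) (y : nat) := y.*2 + b.

(** Without the spine this is the Cartesian product of a star and a path with [2(n + 1)]
    vertices. *)
Definition slow_rel : rel (apexed_star_vertex * 'I_n.+1) := fun u v =>
  match u, v with
  | (None, y), (None, z) => (y.+1 == z) || (z.+1 == y)
  | (Some (i, b), y), (Some (j, c), z) =>
      if i == j then
        ((column_height b y).+1 == column_height c z)
        || ((column_height c z).+1 == column_height b y)
      else star_rel i j && (b == c) && (y == z)
  | (_, y), (_, z) => y == z
  end.

Lemma slow_sym : symmetric slow_rel.
Proof.
move=> [[[i b]|] y] [[[j c]|] z] //=; last by rewrite orbC.
by rewrite (eq_sym j) (eq_sym c) (eq_sym z) star_sym orbC.
Qed.

Lemma slow_irr : irreflexive slow_rel.
Proof. by move=> [[[i b]|] y] /=; rewrite ?eqxx; lia. Qed.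

Definition slow_graph : sgraph := SGraph slow_sym slow_irr.

(** The identity is an embedding: consecutive heights lie in the same layer or in consecutive
    ones. *)
Lemma row_treewidth_slow_graph : row_treewidth slow_graph <= 4.
Proof.
have [_ min_rtw] := leastP (row_treewidth_subproof slow_graph).
apply: leq_trans treewidth_apexed_star; apply: min_rtw.
exists apexed_star, n; split=> //.
exists id; split=> // u v uv; apply/and3P; split.
- by apply: contraTneq uv => ->; rewrite adj_irr.
- rewrite /= /apexed_star_rel orb_andr orbN /=; move: uv.
  case: u v => [[[[i|] b]|] y] [[[[j|] c]|] z] //=; rewrite ?orbT //.
  by case: eqVneq => [[->]|]; rewrite ?eqxx ?orbT.
move: uv; case: u v => [[[i b]|] y] [[[j c]|] z] //=; rewrite /path_rel.
- rewrite /column_height; case: ifP => _.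
    by rewrite -val_eqE /=; case: b; case: c => /=; lia.
  by case/andP=> _ ->.
- by move=> ->.
- by move=> ->.
- by move=> ->; rewrite orbT.
Qed.

(** * Geodesics have few vertices off the spine *)

Definition layer (u : slow_graph) : nat := u.2.

Definition off_spine (u : slow_graph) : bool := u.1 != None.

(** Added to twice the layer, this gives a potential: the height plus one in a column, twice the
    layer on the spine. A step leaving an off-spine vertex raises it by at most 1, a step leaving a
    spine vertex by at most 2. *)
Definition climb_credit (u : slow_graph) : nat :=
  if u.1 is Some (_, b) then b.+1 else 0.

(** The mirror image, for heights counted downwards. *)
Definition descent_credit (u : slow_graph) : nat :=
  if u.1 is Some (_, b) then (~~ b).+1 else 0.

(* Two steps of an off-spine path gain at most one layer, so twice the number
   of steps that gain no layer bounds the number of off-spine vertices. *)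
Lemma count_off_spine_climb (x : slow_graph) p : path (@adj slow_graph) x p ->
  count off_spine (x :: p) + (layer (last x p)).*2
    <= (size p).*2 + (layer x).*2 + climb_credit x.
Proof.
have step (u v : slow_graph) : adj u v ->
    off_spine u + (layer v).*2 + climb_credit v <= 2 + (layer u).*2 + climb_credit u.
  case: u v => [[[i b]|] y] [[[j c]|] z]; rewrite /climb_credit /layer /=.
  - rewrite /column_height; case: ifP => _; case: b; case: c => /=;
      rewrite -?val_eqE /=; lia.
  - by move/eqP=> ->; lia.
  - by move/eqP=> ->; case: c; lia.
  - by lia.
elim: p x => [|y p IHp] x /=.
  by case: x => [[[i b]|] y]; rewrite /climb_credit /layer /=; lia.
by case/andP=> /step xy /IHp /=; lia.
Qed.

Lemma count_off_spine_descent (x : slow_graph) p : path (@adj slow_graph) x p ->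
  count off_spine (x :: p) + (layer x).*2
    <= (size p).*2 + (layer (last x p)).*2 + descent_credit x.
Proof.
have step (u v : slow_graph) : adj u v ->
    off_spine u + (layer u).*2 + descent_credit v <= 2 + (layer v).*2 + descent_credit u.
  case: u v => [[[i b]|] y] [[[j c]|] z]; rewrite /descent_credit /layer /=.
  - rewrite /column_height; case: ifP => _; case: b; case: c => /=;
      rewrite -?val_eqE /=; lia.
  - by move/eqP=> ->; lia.
  - by move/eqP=> ->; case: c; lia.
  - by lia.
elim: p x => [|y p IHp] x /=.
  by case: x => [[[i b]|] y]; rewrite /descent_credit /layer /=; lia.
by case/andP=> /step xy /IHp /=; lia.
Qed.

Lemma spine_path (y z : 'I_n.+1) : exists p,
  [/\ path (@adj slow_graph) (None, y) p, last (None, y) p = (None, z)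
    & size p = (y - z) + (z - y)].
Proof.
move: {2}(_ + _) (erefl ((y - z) + (z - y))) => d.
elim: d y => [|d IHd] y yz.
  have -> : y = z by apply/val_inj => /=; lia.
  by exists [::]; split=> //=; lia.
have zn := ltn_ord z; have yn := ltn_ord y.
have [yltz|zley] := ltnP y z.
  have y1 : y.+1 < n.+1 by lia.
  have [|p [ep lp sp]] := IHd (Ordinal y1); first by rewrite /=; lia.
  exists ((None, Ordinal y1) :: p); split=> //=; first by rewrite eqxx ep.
  by rewrite sp /=; lia.
have y1 : y.-1 < n.+1 by lia.
have [|p [ep lp sp]] := IHd (Ordinal y1); first by rewrite /=; lia.
exists ((None, Ordinal y1) :: p); split=> //=; last by rewrite sp /=; lia.
by rewrite ep andbT; apply/orP; right; apply/eqP; lia.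
Qed.

(** The walk follows the spine; entering and leaving it cost at most one step each. *)
Lemma shortcut (u v : slow_graph) : exists p,
  [/\ path (@adj slow_graph) u p, last u p = v
    & size p <= (layer u - layer v) + (layer v - layer u) + 2].
Proof.
rewrite /layer; have [p [ep lp sp]] := spine_path u.2 v.2.
case: u v p ep lp sp => [[i|] y] [[j|] z] p /= ep lp sp.
- exists ((None, y) :: rcons p (Some j, z)).
  rewrite /= rcons_path last_rcons lp ep /= size_rcons; case: i j => i b [j c].
  by rewrite !eqxx; split=> //; lia.
- exists ((None, y) :: p); rewrite /= lp ep; case: i => i b.
  by rewrite eqxx; split=> //; lia.
- exists (rcons p (Some j, z)).
  rewrite /= rcons_path last_rcons lp ep /= size_rcons; case: j => j c.
  by rewrite eqxx; split=> //; lia.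
- by exists p; split=> //; lia.
Qed.

(** If the ends are [d] layers apart, the shortcut bounds the length by [d + 2], and the climb or
    descent estimate leaves at most [2(d + 2) - 2d + 2 = 6] vertices off the spine. *)
Lemma geodesic_off_spine (x : slow_graph) p :
  geodesic x p -> count off_spine (x :: p) <= 6.
Proof.
case=> /andP[ep _] min_p.
have [q0 [eq0 lq0 sq0]] := shortcut x (last x p).
case/shortenP: eq0 lq0 => q eq uq sub lq.
have sq := min_p q _ lq; rewrite /graph_path eq uq in sq.
have {sq sub}: size p <= (layer x - layer (last x p)) + (layer (last x p) - layer x) + 2.
  apply: leq_trans (sq isT) (leq_trans _ sq0).
  by apply: uniq_leq_size sub; case/andP: uq.
have := count_off_spine_climb ep; have := count_off_spine_descent ep.
have : climb_credit x <= 2 /\ descent_credit x <= 2.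
  by rewrite /climb_credit /descent_credit; case: x.1 => [[? []]|].
lia.
Qed.

(** * Crosses and the lower bound *)

Definition cross (ij : 'I_n.+1 * 'I_n.+1) : {set slow_graph} :=
  [set u : slow_graph | match u with
    | (Some (i, b), y) => (i == Some ij.1) || ~~ b && (y == ij.2)
    | _ => false
    end].

(** All vertices are linked to the one where column and row meet: those of the column along it,
    those of the row through the hub. *)
Lemma cross_connected ij : connected_in (cross ij).
Proof.
case: ij => i j; pose C := cross (i, j).
pose e := adj_in C.
have base (y : 'I_n.+1) : (Some (Some i, false), y) \in C by rewrite inE /= eqxx.
have top (y : 'I_n.+1) : (Some (Some i, true), y) \in C by rewrite inE /= eqxx.
have lower y : connect e (Some (Some i, true), y) (Some (Some i, false), y).
  by apply: connect1; rewrite /e /adj_in /= base top eqxx /column_height; lia.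
have down d (y z : 'I_n.+1) : z + d = y ->
    connect e (Some (Some i, false), y) (Some (Some i, false), z).
  elim: d y => [|d IHd] y zy.
    by have -> : y = z; [apply/val_inj => /=; lia | exact: connect0].
  have y1 : y.-1 < n.+1 by have := ltn_ord y; lia.
  apply: connect_trans (IHd (Ordinal y1) _); last by rewrite /=; lia.
  apply: connect_trans (lower (Ordinal y1)); apply: connect1.
  by rewrite /e /adj_in /= base top eqxx /column_height /=; lia.
have column y : connect e (Some (Some i, false), y) (Some (Some i, false), j).
  have [jy|yj] := leqP j y; first by apply: (@down (y - j)); lia.
  by rewrite (connect_in_sym C); apply: (@down (j - y)); lia.
apply: (@connected_in_center slow_graph C (Some (Some i, false), j)).
move=> [[[k b]|] y]; rewrite inE //= => /orP[/eqP->|/andP[/negPf-> /eqP->]].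
  by case: b; [apply: connect_trans (lower y) _|]; apply: column.
have hubC : (Some (None, false), j) \in C by rewrite inE /= eqxx.
have ray l : connect e (Some (Some l, false), j) (Some (None, false), j).
  by apply: connect1; rewrite /e /adj_in /= hubC inE /= eqxx orbT.
apply: (@connect_trans _ _ (Some (None, false), j)).
  by case: k => [k|]; [apply: ray | apply: connect0].
by rewrite (connect_in_sym C); apply: ray.
Qed.

(** At most [n] off-spine vertices miss one of the [n + 1] leaf columns and one of the [n + 1]
    layers, hence the cross of that column with the row in that layer. *)
Lemma hits_crosses (X : {set slow_graph}) :
  (forall ij, exists2 u, u \in cross ij & u \in X) ->
  n < #|[set u in X | off_spine u]|.
Proof.
set Y := [set u in X | _] => hitX; rewrite ltnNge; apply/negP => Yn.
have miss (f : slow_graph -> 'I_n.+1) : exists i, i \notin f @: Y.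
  case: (pickP [pred i | i \notin f @: Y]) => [i iY|allY]; first by exists i.
  have := leq_imset_card f Y; have -> : f @: Y = setT.
    by apply/setP=> i; rewrite inE; apply/negbFE/allY.
  by rewrite cardsT card_ord leqNgt ltnS Yn.
(* The default [ord0] is harmless: it can only rule out one more column, and the image of [Y] still
   has at most [n] elements. *)
pose column (u : slow_graph) :=
  if u.1 is Some (Some i, _) then i else ord0.
have [i iY] := miss column; have [j jY] := miss snd.
have [u uC uX] := hitX (i, j).
have uY : u \in Y by rewrite inE uX; case: u uC {uX} => [[[k b]|] y]; rewrite inE.
move: uC; rewrite inE; case: u uY {uX} => [[[k b]|] y] uY //= /orP[/eqP ki|].
  by case/imsetP: iY; exists (Some (k, b), y); rewrite // /column /= ki.
by case/andP=> _ /eqP yj; case/imsetP: jY; exists (Some (k, b), y).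
Qed.

End Example.

(** Adjacent vertices lie in the same part or in adjacent parts, so paths in [C] project to the
    quotient. *)
Lemma connected_parts (G : sgraph) (P : {set {set G}}) (C : {set G}) :
  partition P [set: G] -> connected_in C ->
  connected_in [set A : quotient P | [exists u in C, u \in val A]].
Proof.
case/and3P=> /eqP covP trivP _ coC A A'; rewrite !inE.
case/exists_inP=> u uC uA /exists_inP[v vC vA'].
set D := finset _.
have inP w : pblock P w \in P by rewrite pblock_mem // covP inE.
pose part w : quotient P := exist _ (pblock P w) (inP w).
have partE w (E : quotient P) : w \in val E -> part w = E.
  by move=> wE; apply/val_inj/def_pblock => //; apply: valP.
rewrite -(partE u A uA) -(partE v A' vA').
have wp w : w \in val (part w) by rewrite /= mem_pblock covP inE.
have partD w : w \in C -> part w \in D.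
  by move=> wC; rewrite inE; apply/exists_inP; exists w.
apply: connect_homo (coC u v uC vC) => x y /and3P[xy xC yC].
have [->|ne] := eqVneq (part x) (part y); first exact: connect0.
apply: connect1; rewrite /adj_in /= !partD // !andbT /quotient_rel ne /=.
by apply/exists_inP; exists x => //; apply/exists_inP; exists y.
Qed.

(** The bramble is transferred to the quotient: the parts meeting a cross form a connected set, and
    the union of the parts in a suitable bag meets every cross. *)
Lemma geodesic_treewidth_slow_graph n :
  n < 6 * (geodesic_treewidth (slow_graph n)).+1.
Proof.
rewrite /geodesic_treewidth; set exk := geodesic_treewidth_subproof _.
have [[P [[partP geoP] <-]] _] := leastP exk.
rewrite /treewidth; have [[T [B [tdB <-]]] _] := leastP (treewidth_subproof (quotient P)).
pose C ij := [set A : quotient P | [exists u in cross ij, u \in val A]].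
have /and3P[/eqP covP _ _] := partP.
have [||t tC] := @bag_meets_bramble _ _ B _ C tdB.
- by move=> ij; apply/connected_parts/cross_connected.
(* Two crosses share the vertex where the column of one meets the row of the other. *)
- move=> ij kl; pose u : slow_graph n := (Some (Some ij.1, false), kl.2).
  have /bigcupP[A AP uA] : u \in cover P by rewrite covP inE.
  by exists (exist _ A AP); rewrite inE; apply/exists_inP; exists u;
    rewrite // inE /= !eqxx ?orbT.
have lt := @hits_crosses n (\bigcup_(A in B t) val A).
apply: leq_trans (lt _) _.
  move=> ij; have [A] := tC ij; rewrite inE => /exists_inP[u uC uA] AB.
  by exists u => //; apply/bigcupP; exists A.
apply: (@leq_trans (\sum_(A in B t) 6)).
  apply: (@leq_trans #|\bigcup_(A in B t) [set u in val A | off_spine u]|).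
    apply/subset_leq_card/subsetP => u; rewrite inE => /andP[/bigcupP[A AB uA] ou].
    by apply/bigcupP; exists A; rewrite // inE uA.
  elim/big_rec2: _ => [|A k X _ IH]; first by rewrite cards0.
  apply: leq_trans (leq_card_setU _ _).1 _; apply: leq_add IH.
  have [x [p [geo ->]]] := geoP _ (valP A).
  apply: leq_trans (geodesic_off_spine geo); rewrite -size_filter.
  apply: leq_trans (card_size _); apply/subset_leq_card/subsetP => u.
  by rewrite !inE mem_filter andbC inE.
(* A bag has at most width plus one parts; [leqSpred] undoes the truncated predecessor. *)
rewrite sum_nat_const mulnC leq_mul2l /=; apply: leq_trans (leqSpred _).
exact: (leq_bigmax t).
Qed.

Theorem theorem1 :
  exists C : sgraph -> Prop,
    admits_product_structure C /\ ~ admits_geodesic_structure C.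
Proof.
exists (fun G => exists n, G = slow_graph n); split.
  by exists 4 => _ [n ->]; apply: row_treewidth_slow_graph.
case=> c bc; have := @geodesic_treewidth_slow_graph (6 * c.+1).
by have := bc _ (ex_intro _ (6 * c.+1) erefl); lia.
Qed.
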